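(* Let $d\ge 1$, let $\mathcal{M}_1,\dots,\mathcal{M}_d$ be Markov chains on state spaces $\Sigma_1,\dots,\Sigma_d$ with stationary distributions $\pi_1,\dots,\pi_d$, let $\omega:\Sigma_1\times\dots\times\Sigma_d\to\mathbb{R}$ be a label function, let $\mathbf{k}=(k_1,\dots,k_d)$ be a vector of nonnegative integers, and let $\varepsilon>0$ and $\alpha>0$. Let $\boldsymbol{\sigma}_0=(\sigma_0^1,\dots,\sigma_0^d)\in\Sigma_1\times\dots\times\Sigma_d$ (with $\pi_i(\sigma_0^i)>0$ for each $i$), and suppose that $\boldsymbol{\sigma}_0$ is not an $(\varepsilon,\alpha)$-outlier with respect to $\mathbf{k}$ (in the product-space sense defined in the context). Then $$p^{\mathbf{k}}_{\mathbf{U},\varepsilon}(\boldsymbol{\sigma}_0)\le\frac{\varepsilon}{\alpha}.$$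
   Context: Markov chains are time-homogeneous, discrete-time, on discrete (finite or countable) state spaces. For a stationary distribution $\pi_i$ of $\mathcal{M}_i$, a trajectory $X^i_0,X^i_1,\dots$ of $\mathcal{M}_i$ is stationary if $X^i_0\sim\pi_i$. Write $\Sigma^{[d]}=\Sigma_1\times\dots\times\Sigma_d$ and $\pi^{[d]}=\pi_1\times\dots\times\pi_d$ (product distribution). A real number $a_0$ is an $\varepsilon$-outlier among a finite list $a_0,\dots,a_N$ if $\#\{i\in\{0,\dots,N\}: a_i\le a_0\}\le \varepsilon(N+1)$. Trajectory product: given $\boldsymbol{\sigma}=(\sigma^1,\dots,\sigma^d)\in\Sigma^{[d]}$ with all $\pi_i(\sigma^i)>0$, and integer vectors $\mathbf{j}=(j_1,\dots,j_d)$, $\mathbf{k}=(k_1,\dots,k_d)$ with $0\le j_i\le k_i$, take for each $i$, independently over $i$, a stationary trajectory $X^i_0,\dots,X^i_{k_i}$ of $\mathcal{M}_i$ conditioned on $X^i_{j_i}=\sigma^i$. The trajectory product $\mathbf{X}_{\boldsymbol{\sigma},\mathbf{j},\mathbf{k}}$ is the (random) collection of all $\prod_i(k_i+1)$ $d$-tuples consisting of one element from each of these trajectories (indexed by the choices of positions, hence counted with multiplicity). It contains $\boldsymbol{\sigma}$ as the tuple at position $\mathbf{j}$. Define $$p^{\mathbf{k}}_{\mathbf{U},\varepsilon}(\boldsymbol{\sigma}):=\Pr\big(\omega(\boldsymbol{\sigma})\text{ is an }\varepsilon\text{-outlier among the }\omega\text{-labels of the elements of }\mathbf{X}_{\boldsymbol{\sigma},\mathbf{j},\mathbf{k}}\big),$$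 where $\mathbf{j}=(j_1,\dots,j_d)$ is chosen randomly, with the $j_i$ independent and $j_i$ uniform on $\{0,1,\dots,k_i\}$. The state $\boldsymbol{\sigma}_0$ is an $(\varepsilon,\alpha)$-outlier with respect to $\mathbf{k}$ if $p^{\mathbf{k}}_{\mathbf{U},\varepsilon}(\boldsymbol{\sigma}_0)$ is in the largest $\alpha$ fraction of the values $p^{\mathbf{k}}_{\mathbf{U},\varepsilon}(\boldsymbol{\sigma})$ over all states $\boldsymbol{\sigma}\in\Sigma^{[d]}$, weighted according to $\pi^{[d]}$; that is, if $\Pr_{\boldsymbol{\sigma}\sim\pi^{[d]}}\big(p^{\mathbf{k}}_{\mathbf{U},\varepsilon}(\boldsymbol{\sigma})\ge p^{\mathbf{k}}_{\mathbf{U},\varepsilon}(\boldsymbol{\sigma}_0)\big)\le\alpha$. *)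

(* Defs.v *)
From mathcomp Require Import all_boot all_order all_algebra.
From mathcomp Require Import all_classical all_reals all_analysis.

Set Implicit Arguments.
Unset Strict Implicit.
Unset Printing Implicit Defensive.

Import Order.TTheory GRing.Theory Num.Theory.
Local Open Scope classical_set_scope.
Local Open Scope ring_scope.

(* Discrete distributions are given by their mass functions; a countType is a
   finite or countably infinite space. *)
Definition is_pmf (R : realType) (T : countType) (f : T -> R) : Prop :=
  (forall x, 0 <= f x) /\ \esum_(x in [set: T]) (f x)%:E = 1%E.

Definition Pr (R : realType) (T : countType) (f : T -> R) (E : set T) :
    \bar R :=
  \esum_(x in E) (f x)%:E.

(* If E is a null event, this is identically 0, since 0^-1 = 0. *)
Definition cond_pmf (R : realType) (T : countType) (f : T -> R) (E : set T)
    (x : T) : R :=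
  f x * \1_E x / fine (Pr f E).

Definition unif_pmf (R : realType) (n : nat) (_ : 'I_n.+1) : R := n.+1%:R^-1.

Definition prod_pmf (R : realType) (d : nat) (T : 'I_d -> Type)
    (f : forall i, T i -> R) (x : forall i, T i) : R :=
  \prod_(i < d) f i (x i).

Definition is_kernel (R : realType) (T : countType) (P : T -> T -> R) : Prop :=
  forall x, is_pmf (P x).

Definition stationary (R : realType) (T : countType) (P : T -> T -> R)
    (pi : T -> R) : Prop :=
  is_pmf pi /\
  forall y, \esum_(x in [set: T]) (pi x * P x y)%:E = (pi y)%:E.

Definition trajectory (T : countType) (k : nat) : countType :=
  {ffun 'I_k.+1 -> T}.

(* Joint law of (X_0, ..., X_k) for the chain P started from X_0 ~ pi. *)
Definition traj_pmf (R : realType) (T : countType) (P : T -> T -> R)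
    (pi : T -> R) (k : nat) (x : trajectory T k) : R :=
  pi (x ord0) *
  \prod_(t < k) P (x (widen_ord (leqnSn k) t)) (x (lift ord0 t)).

(* s is the whole list a_0, ..., a_N, including a_0 itself. *)
Definition is_outlier (R : realType) (eps a0 : R) (s : seq R) : Prop :=
  (count (fun a => a <= a0) s)%:R <= eps * (size s)%:R.

Definition state (d : nat) (S : 'I_d -> countType) : countType :=
  {dffun forall i : 'I_d, S i}.

Definition position (d : nat) (k : 'I_d -> nat) : finType :=
  {dffun forall i : 'I_d, 'I_(k i).+1}.

Definition trajectories (d : nat) (S : 'I_d -> countType) (k : 'I_d -> nat) :
    countType :=
  {dffun forall i : 'I_d, trajectory (S i) (k i)}.

Section TrajectoryProduct.
Variables (R : realType) (d : nat) (S : 'I_d -> countType).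
Variables (P : forall i, S i -> S i -> R) (pi : forall i, S i -> R).
Variables (omega : state S -> R) (k : 'I_d -> nat).

Definition tuple_at (X : trajectories S k) (m : position k) : state S :=
  [ffun i => X i (m i)].

(* One label per position, so labels are counted with multiplicity. *)
Definition label_list (X : trajectories S k) : seq R :=
  [seq omega (tuple_at X m) | m <- enum (position k)].

(* Law of the independent stationary trajectories, the i-th one conditioned on
   X^i_(j_i) = sigma^i. *)
Definition cond_trajectories_pmf (sigma : state S) (j : position k)
    (X : trajectories S k) : R :=
  prod_pmf (fun i => cond_pmf (traj_pmf (@P i) (@pi i) (k := k i))
                       [set x | x (j i) = sigma i]) X.

(* Joint law of the uniform random position j and, given j, of the trajectories
   conditioned on going through sigma at position j. *)
Definition random_pos_pmf (sigma : state S)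
    (jX : position k * trajectories S k) : R :=
  prod_pmf (fun i => @unif_pmf R (k i)) jX.1 *
  cond_trajectories_pmf sigma jX.1 jX.2.

Definition p_unif (eps : R) (sigma : state S) : \bar R :=
  Pr (random_pos_pmf sigma)
     [set jX | is_outlier eps (omega sigma) (label_list jX.2)].

Definition is_eps_alpha_outlier (eps alpha : R) (sigma0 : state S) : Prop :=
  (Pr (fun sigma : state S => prod_pmf pi sigma)
     [set sigma | p_unif eps sigma0 <= p_unif eps sigma] <= alpha%:E)%E.

End TrajectoryProduct.

(* Main.v *)
Require Import Defs.
From mathcomp Require Import all_boot all_order all_algebra.
From mathcomp Require Import all_classical all_reals all_analysis.

(** Markov's inequality reduces the bound to the claim that the mean of
    p(sigma) over sigma ~ pi^[d] is at most eps.  Drawing sigma from pi^[d] and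
    then trajectories conditioned on passing through sigma at position j is the
    same as drawing unconditioned stationary trajectories X, independently of j,
    and putting sigma := the tuple of X at j.  Given X, at most a fraction eps
    of the positions j carry an eps-outlier, and j is uniform. *)

Set Implicit Arguments.
Unset Strict Implicit.
Unset Printing Implicit Defensive.

Import Order.TTheory GRing.Theory Num.Theory.
Local Open Scope classical_set_scope.
Local Open Scope ring_scope.

(** * Rearranging sums of nonnegative extended reals *)

Lemma esumZl (R : realType) (T : choiceType) (A : set T) (c : R)
    (a : T -> \bar R) : 0 <= c -> (forall x, 0 <= a x)%E ->
  (\esum_(x in A) (c%:E * a x) = c%:E * \esum_(x in A) a x)%E.
Proof.
move=> c0 a0; rewrite /esum -ereal_supZl //.
  rewrite image_comp; congr ereal_sup; apply: eq_imagel => X _.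
  by rewrite /= ge0_mule_fsumr.
by apply/set0P; exists 0%E; exists set0; [exact: fsets_set0|rewrite fsbig_set0].
Qed.

(** Both sides sum over the pairs [(f x, x)]. This serves as the law of total probability below. *)
Lemma esum_fiber (R : realType) (T U : choiceType) (f : T -> U) (A : set T)
    (a : T -> \bar R) : (forall x, A x -> 0 <= a x)%E ->
  (\esum_(x in A) a x =
   \esum_(u in [set: U]) \esum_(x in A `&` [set x | f x = u]) a x)%E.
Proof.
move=> a0; rewrite esum_esum; last by move=> u x _ [/a0].
apply: reindex_esum; split.
- by move=> [u x] /= [_ []].
- by move=> [u x] [v y]; rewrite !inE /= => -[_ [_ <-]] [_ [_ <-]] ->.
- by move=> x Ax; exists (f x, x).
Qed.

Lemma esum_set1_ge0 (R : realType) (T : choiceType) (A : set T) (x0 : T)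
    (a : T -> \bar R) : A = [set x0] -> (0 <= a x0)%E ->
  (\esum_(x in A) a x)%E = a x0.
Proof. by move=> ->; exact: esum_set1. Qed.

(** * Marginals and total mass of one stationary trajectory *)

Section Trajectory.
Variables (R : realType) (T : countType) (P : T -> T -> R) (pi : T -> R).
Hypothesis P_kernel : is_kernel P.
Hypothesis pi_stationary : stationary P pi.

Let trunc k (z : trajectory T k.+1) : trajectory T k :=
  [ffun i => z (lift ord_max i)].

Let snoc k (x : trajectory T k) (y : T) : trajectory T k.+1 :=
  [ffun i => oapp x y (unlift ord_max i)].

Let trunc_snoc k (x : trajectory T k) y : trunc (snoc x y) = x.
Proof. by apply/ffunP => i; rewrite !ffunE liftK. Qed.

Let snoc_last k (x : trajectory T k) y : snoc x y ord_max = y.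
Proof. by rewrite ffunE unlift_none. Qed.

Let snoc_lift k (x : trajectory T k) y i : snoc x y (lift ord_max i) = x i.
Proof. by rewrite ffunE liftK. Qed.

Let snoc_trunc k (z : trajectory T k.+1) : snoc (trunc z) (z ord_max) = z.
Proof.
by apply/ffunP => i; rewrite ffunE; case: unliftP => [j|] -> //=; rewrite ffunE.
Qed.

Lemma traj_pmf_ge0 k (x : trajectory T k) : 0 <= traj_pmf P pi x.
Proof.
apply: mulr_ge0; first by case: pi_stationary => -[].
by apply: prodr_ge0 => t _; case: (P_kernel (x (widen_ord (leqnSn k) t))).
Qed.

Let traj_pmf_snoc k (x : trajectory T k) y :
  traj_pmf P pi (snoc x y) = traj_pmf P pi x * P (x ord_max) y.
Proof.
(* Once the last transition is split off, every remaining index into [snoc x y] is some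
   [lift ord_max i], where [snoc x y] agrees with [x]. *)
have widenE t : widen_ord (leqnSn k.+1) t = lift ord_max t.
  by apply: val_inj; rewrite /= /bump leqNgt ltn_ord.
have lift0E t : lift ord0 (widen_ord (leqnSn k) t) = lift ord_max (lift ord0 t).
  by apply: val_inj; rewrite /= /bump /= leqNgt ltnS ltn_ord.
have lift0_max : lift ord0 ord_max = ord_max :> 'I_k.+2 by apply: val_inj.
have ord0E : ord0 = lift ord_max ord0 :> 'I_k.+2 by apply: val_inj.
rewrite /traj_pmf big_ord_recr mulrA /= lift0_max snoc_last {1}ord0E.
rewrite widenE !snoc_lift; congr (_ * _ * _).
by apply: eq_bigr => t _; rewrite widenE lift0E !snoc_lift.
Qed.

(** Induction on [k], fibering over the truncated trajectory. For [j] before the end, the last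
    transition sums out to 1; for [j] at the end, stationarity carries [pi] across the last
    transition. *)
Lemma traj_marginal k (j : 'I_k.+1) (s : T) :
  Pr (@traj_pmf R T P pi k) [set x | x j = s] = (pi s)%:E.
Proof.
have t0 m (x : trajectory T m) : (0 <= (traj_pmf P pi x)%:E)%E.
  by rewrite lee_fin traj_pmf_ge0.
rewrite /Pr; elim: k => [|k IH] in j s *.
  rewrite (@esum_set1_ge0 _ _ _ [ffun=> s]) //.
    by rewrite /traj_pmf big_ord0 mulr1 ffunE.
  apply/seteqP; split => [x /= <-|x /= ->]; last by rewrite ffunE.
  by apply/ffunP => i; rewrite ffunE !ord1.
rewrite (@esum_fiber _ _ _ (@trunc k)) //.
case: (unliftP ord_max j) => [i|] ->.
  rewrite -[RHS](IH i) [RHS]esum_mkcond; apply: eq_esum => x _.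
  have [xi|xi] := pselect (x i = s);
    [rewrite mem_set //|rewrite memNset //]; last first.
    by apply: esum1 => z [/= zi zx]; case: xi; rewrite -zx ffunE.
  rewrite (@reindex_esum _ _ _ [set: T] _ (snoc x)).
    under eq_esum do rewrite traj_pmf_snoc EFinM.
    rewrite esumZl ?traj_pmf_ge0 //.
      by case: (P_kernel (x ord_max)) => _ ->; rewrite mule1.
    by move=> y; rewrite lee_fin; case: (P_kernel (x ord_max)).
  split.
  - by move=> y _ /=; rewrite snoc_lift trunc_snoc.
  - by move=> y1 y2 _ _ y12; rewrite -(snoc_last x y1) y12 snoc_last.
  - by move=> z /= [_ <-]; exists (z ord_max) => //; rewrite snoc_trunc.
(* With the endpoint fixed to [s], each fiber is the single trajectory [snoc x s]. *)
transitivity (\esum_(x in [set: trajectory T k])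
    (traj_pmf P pi x * P (x ord_max) s)%:E)%E.
  apply: eq_esum => x _; rewrite -traj_pmf_snoc; apply: esum_set1_ge0 => //.
  apply/seteqP; split => [z /= [<- <-]|z /= ->].
    by rewrite snoc_trunc.
  by rewrite snoc_last trunc_snoc.
have P0 u v : 0 <= P u v by case: (P_kernel u).
(* Group by the penultimate state [u], which has law [pi] by induction. *)
rewrite (@esum_fiber _ _ _ (fun x : trajectory T k => x ord_max)); last first.
  by move=> x _; rewrite lee_fin mulr_ge0 // traj_pmf_ge0.
case: pi_stationary => _ <-; apply: eq_esum => u _.
rewrite setTI EFinM muleC -(IH ord_max u) -esumZl //.
by apply: eq_esum => x /= ->; rewrite -EFinM mulrC.
Qed.

Lemma traj_total k :
  (\esum_(x in [set: trajectory T k]) (traj_pmf P pi x)%:E = 1)%E.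
Proof.
rewrite (@esum_fiber _ _ _ (fun x : trajectory T k => x ord_max)); last first.
  by move=> x _; rewrite lee_fin traj_pmf_ge0.
case: pi_stationary => -[_ <-] _; apply: eq_esum => s _.
by rewrite setTI -(traj_marginal (k := k) ord_max s).
Qed.

End Trajectory.

(** * Mass of product laws, and counting in finite types *)

Lemma esum_prod_le1 (R : realType) (I : finType) (T : I -> countType)
    (f : forall i, T i -> R) : (forall i x, 0 <= f i x) ->
    (forall i, \esum_(x in [set: T i]) (f i x)%:E <= 1)%E ->
  (\esum_(X in [set: {dffun forall i, T i}]) (\prod_i f i (X i))%:E <= 1)%E.
Proof.
move=> f0 f1.
(* Generalized for induction: [r] lists the coordinates that may still vary on [A]. Fibering over
   one coordinate freezes it, and when [r] is empty [A] has at most one element. *)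
suff fr (r : seq I) (A : set {dffun forall i, T i}) :
    (forall X Y, A X -> A Y -> forall i, i \notin r -> X i = Y i) ->
    (\esum_(X in A) (\prod_(i <- r) f i (X i))%:E <= 1)%E.
  by apply: fr => X Y _ _ i; rewrite mem_index_enum.
elim: r A => [|i r IH] A A_eq.
  have [->|/set0P[X AX]] := eqVneq A set0; first by rewrite esum_set0.
  rewrite (_ : A = [set X]) ?esum_set1 ?big_nil ?lee_fin //.
  apply/seteqP; split=> [Y AY /=|Y -> //].
  by apply/ffunP => i; apply: A_eq.
rewrite (@esum_fiber _ _ _ (fun X : {dffun forall i, T i} => X i)); last first.
  by move=> X _; rewrite lee_fin prodr_ge0.
apply: le_trans (f1 i); apply: le_esum => v _.
have -> : (\esum_(X in A `&` [set X | X i = v])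
      (\prod_(j <- i :: r) f j (X j))%:E =
    (f i v)%:E * \esum_(X in A `&` [set X | X i = v])
      (\prod_(j <- r) f j (X j))%:E)%E.
  rewrite -esumZl //; last by move=> X; rewrite lee_fin prodr_ge0.
  by apply: eq_esum => X [_ /= <-]; rewrite big_cons.
rewrite -[leRHS]mule1 lee_wpmul2l ?lee_fin //.
apply: IH => X Y [AX /= Xv] [AY /= Yv] j jr.
have [->|ji] := eqVneq j i; first by rewrite Xv Yv.
by apply: A_eq => //; rewrite inE negb_or ji.
Qed.

(* All the indices counted on the left have a value at most the largest value
   [a i] among them, and there are at most [c] indices [m] with [a m <= a i]. *)
Lemma card_low_rank_le (R : realType) (I : finType) (a : I -> R) (c : R) :
  0 <= c ->
  #|[pred i | #|[pred m | a m <= a i]|%:R <= c]|%:R <= c.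
Proof.
move=> c0; set Q := [pred i | _].
case: (pickP Q) => [i0 Qi0|Q0]; last by rewrite eq_card0.
case: (@arg_maxP _ _ _ i0 Q a Qi0) => i Qi imax.
apply: le_trans Qi; rewrite ler_nat subset_leq_card //.
by apply/fintype.subsetP => m /imax.
Qed.

Lemma esum_const_fin (R : realType) (I : finType) (Q : {pred I}) (c : R) :
  0 <= c -> (\esum_(i in [set i | i \in Q]) c%:E = (c *+ #|Q|)%:E)%E.
Proof.
move=> c0; rewrite (_ : [set i | i \in Q] = [set` enum Q]); last first.
  by apply/seteqP; split=> i /=; rewrite mem_enum.
rewrite esum_fset //.
by rewrite -fsbig_seq ?enum_uniq // sumEFin big_enum sumr_const.
Qed.

(** * The mean of [p_unif] under the product distribution *)

Section Expectation.
Variables (R : realType) (d : nat) (S : 'I_d -> countType).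
Variables (P : forall i, S i -> S i -> R) (pi : forall i, S i -> R).
Hypothesis P_kernel : forall i, is_kernel (@P i).
Hypothesis pi_stationary : forall i, stationary (@P i) (@pi i).
Variables (omega : state S -> R) (k : 'I_d -> nat).

Let law (X : trajectories S k) : R :=
  prod_pmf (fun i => traj_pmf (@P i) (@pi i) (k := k i)) X.

Let pi_ge0 i x : 0 <= @pi i x.
Proof. by case: (pi_stationary i) => -[]. Qed.

Let traj_ge0 i (x : trajectory (S i) (k i)) : 0 <= traj_pmf (@P i) (@pi i) x.
Proof. exact: traj_pmf_ge0. Qed.

Let law_ge0 X : 0 <= law X.
Proof. exact: prodr_ge0. Qed.

Lemma unif_position (j : position k) :
  prod_pmf (fun i => @unif_pmf R (k i)) j = #|position k|%:R^-1.
Proof.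
rewrite card_dep_ffun foldrE big_map big_enum /= natr_prod -prodfV.
by apply: eq_bigr => i _; rewrite card_ord.
Qed.

Let weight_ge0 (sigma : state S) : 0 <= prod_pmf pi sigma.
Proof. exact: prodr_ge0. Qed.

(** By [traj_marginal] the weight of [sigma] is the product of the normalizing constants of the
    conditioning, so the two cancel. Where some [pi] factor is 0 the left side vanishes, and the
    bound still holds. *)
Lemma weight_cond_le (sigma : state S) (j : position k) (X : trajectories S k) :
  prod_pmf pi sigma * cond_trajectories_pmf P pi sigma j X <=
  if tuple_at X j == sigma then law X else 0.
Proof.
rewrite /cond_trajectories_pmf /prod_pmf -big_split /=.
case: eqP => [<-|neq].
  apply: ler_prod => i _; rewrite /cond_pmf traj_marginal // ffunE /=.
  rewrite indicE mem_set //= mulr1.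
  have [->|p0] := eqVneq (pi (X i (j i))) 0.
    by rewrite mul0r lexx traj_ge0.
  by rewrite mulrC divfK // lexx traj_ge0.
(* One coordinate missing [sigma] has indicator 0, which kills the product. *)
have [i Xi] : exists i, X i (j i) <> sigma i.
  apply: contrapT => /forallNP eqX; apply: neq; apply/ffunP => i.
  by rewrite ffunE; apply: contrapT; exact: eqX.
by rewrite (bigD1 i) //= /cond_pmf indicE memNset //= mulr0 mul0r mulr0 mul0r.
Qed.

Lemma cond_trajectories_pmf_ge0 (sigma : state S) (j : position k)
    (X : trajectories S k) :
  0 <= cond_trajectories_pmf P pi sigma j X.
Proof.
apply: prodr_ge0 => i _; rewrite /cond_pmf traj_marginal //=.
by rewrite divr_ge0 // mulr_ge0 // indicE.
Qed.

Lemma random_pos_pmf_ge0 (sigma : state S)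
    (jX : position k * trajectories S k) :
  0 <= random_pos_pmf P pi sigma jX.
Proof.
by rewrite mulr_ge0 ?cond_trajectories_pmf_ge0 // unif_position invr_ge0.
Qed.

Lemma p_unif_ge0 eps (sigma : state S) : (0 <= p_unif P pi omega k eps sigma)%E.
Proof. by apply: esum_ge0 => jX _; rewrite lee_fin random_pos_pmf_ge0. Qed.

Let outlier_positions (eps : R) (X : trajectories S k) : {pred position k} :=
  [pred j | #|[pred m | omega (tuple_at X m) <= omega (tuple_at X j)]|%:R
            <= eps * #|position k|%:R].

Let is_outlierE eps X j :
  is_outlier eps (omega (tuple_at X j)) (label_list omega X) =
  (j \in outlier_positions eps X).
Proof.
have countE (p : pred (position k)) : count p (enum (position k)) = #|p|.
  by rewrite cardE [in RHS]/enum_mem size_filter -enumT.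
by rewrite /is_outlier count_map size_map -cardE countE inE.
Qed.

Lemma expected_p_unif_le eps : 0 <= eps ->
  (\esum_(sigma in [set: state S])
     ((prod_pmf pi sigma)%:E * p_unif P pi omega k eps sigma) <= eps%:E)%E.
Proof.
move=> eps0; set N := #|position k|; pose u : R := N%:R^-1.
have u0 : 0 <= u by rewrite invr_ge0.
have N0 : N%:R != 0 :> R.
  by rewrite pnatr_eq0 -lt0n; apply/card_gt0P; exists [ffun=> ord0].
pose G : set (position k * trajectories S k) :=
  [set jX | jX.1 \in outlier_positions eps jX.2].
(* The joint law of a uniform position and independent unconditioned trajectories. *)
pose w (jX : position k * trajectories S k) : \bar R := (u * law jX.2)%:E.
have w0 jX : (0 <= w jX)%E by rewrite lee_fin mulr_ge0.
apply: (@le_trans _ _ (\esum_(jX in G) w jX)%E).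
  rewrite (@esum_fiber _ _ _ (fun jX => tuple_at jX.2 jX.1)) //.
  apply: le_esum => sigma _; rewrite -esumZl //; last first.
    by move=> jX; rewrite lee_fin random_pos_pmf_ge0.
  set E := [set jX | is_outlier _ _ _]; set F := [set jX | tuple_at _ _ = _].
  (* On [F], [sigma] is the tuple read off at the position, so both outlier conditions agree. *)
  have -> : G `&` F = E `&` F.
    apply/seteqP; split=> jX [] /= h jXs; split=> //; move: h;
    by rewrite /G /E /= -jXs is_outlierE.
  rewrite esum_mkcondr; apply: le_esum => -[j X] _.
  rewrite /random_pos_pmf unif_position -EFinM mulrCA /=.
  have := ler_wpM2l u0 (weight_cond_le sigma j X).
  case: eqP => [e|ne]; [rewrite mem_set //|rewrite memNset //].
  by rewrite mulr0.
(* The same sum is now fibered over [X]: at most [eps * N] positions lie in a fiber, each of weight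
   [law X / N]. *)
rewrite (@esum_fiber _ _ _ snd) //.
rewrite -[leRHS]mule1; apply: (@le_trans _ _
    (\esum_(X in [set: trajectories S k]) (eps%:E * (law X)%:E))%E); last first.
  rewrite esumZl //.
  rewrite lee_wpmul2l ?lee_fin //; apply: esum_prod_le1 => // i.
  by rewrite traj_total.
apply: le_esum => X _.
rewrite (@reindex_esum _ _ _ [set j | j \in outlier_positions eps X] _
           (pair^~ X)).
  rewrite /w /= esum_const_fin ?mulr_ge0 // -EFinM lee_fin.
  rewrite -mulrnAl ler_wpM2r // -mulr_natl ler_pdivrMr ?lt0r ?N0 //=.
  by apply: card_low_rank_le; rewrite mulr_ge0.
split.
- by move=> j.
- by move=> j1 j2 _ _ [].
- by move=> [j Y] /= [h <-]; exists j.
Qed.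

End Expectation.

Theorem theorem7p3 (R : realType) (d : nat) (d_gt0 : (0 < d)%N)
    (S : 'I_d -> countType)
    (P : forall i : 'I_d, S i -> S i -> R) (pi : forall i : 'I_d, S i -> R)
    (P_kernel : forall i : 'I_d, is_kernel (P i))
    (pi_stationary : forall i : 'I_d, stationary (P i) (pi i))
    (omega : state S -> R) (k : 'I_d -> nat)
    (eps alpha : R) (eps_gt0 : 0 < eps) (alpha_gt0 : 0 < alpha)
    (sigma0 : state S) (sigma0_gt0 : forall i : 'I_d, 0 < pi i (sigma0 i))
    (sigma0_not_outlier :
       ~ is_eps_alpha_outlier P pi omega k eps alpha sigma0) :
  (p_unif P pi omega k eps sigma0 <= (eps / alpha)%:E)%E.
Proof.
have eps0 := ltW eps_gt0.
have pi0 i x : 0 <= pi i x by case: (pi_stationary i) => -[].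
have mu0 (sigma : state S) : 0 <= prod_pmf pi sigma by exact: prodr_ge0.
have p0 := @p_unif_ge0 _ _ _ _ _ P_kernel pi_stationary omega k eps.
move/negP: sigma0_not_outlier; rewrite -ltNge /Pr.
set B := [set sigma | _] => alpha_lt.
(* Markov's inequality on [B], whose mass exceeds [alpha]. It is stated for real [r] because
   [p_unif] is an extended real not yet known to be finite. *)
have markov r : 0 <= r -> (r%:E <= p_unif P pi omega k eps sigma0)%E ->
    r <= eps / alpha.
  move=> r0 rp; rewrite ler_pdivlMr // -lee_fin EFinM.
  apply: le_trans (expected_p_unif_le P_kernel pi_stationary omega k eps0).
  apply: (@le_trans _ _ (r%:E * \esum_(sigma in B) (prod_pmf pi sigma)%:E)%E).
    by rewrite lee_wpmul2l ?lee_fin // ltW.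
  rewrite -esumZl // esum_mkcond; apply: le_esum => sigma _.
  case: ifPn => [|_]; last by rewrite mule_ge0 ?lee_fin.
  rewrite inE /B /= => sigmaB.
  by rewrite muleC lee_wpmul2l ?lee_fin // (le_trans rp).
case: (p_unif _ _ _ _ _ _) (p0 sigma0) markov => [r| |//] r0 markov.
  by rewrite lee_fin markov.
(* An infinite value would allow [r := eps / alpha + 1], which contradicts [markov]. *)
have q0 : 0 <= eps / alpha by rewrite divr_ge0 // ltW.
by have := markov (eps / alpha + 1); rewrite leey gerDl ler10 addr_ge0 //;
  move=> /(_ isT isT).
Qed.
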